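(* Let $n$ be a positive integer, and consider the following statements: (i) There is an $n$-satisfactory coloring of $K_n$. (ii) $T_n$ essentially tiles the orthant $\mathbb O_n$. (iii) $\mathbb Z^{\pi(n)}$ can be tiled by $T_n$. (iv) There is an $n$-satisfactory coloring of $\hat K_n=\{a/b:a,b\in K_n\}$. Then (i) implies (iii), and therefore (i)--(iv) are all equivalent.
   Context: $[n]=\{1,\dots,n\}$. $K_n$ is the set of positive integers all of whose prime factors are less than or equal to $n$. For $X=K_n$ or $X=\hat K_n$, an $n$-satisfactory coloring of $X$ is a coloring of $X$ using exactly $n$ colors such that for every $a\in X$ the elements $a,2a,\dots,na$ all receive different colors. $\pi(n)$ is the number of primes less than or equal to $n$, and $p_1<\dots<p_{\pi(n)}$ are these primes. $\mathbb O_n=\mathbb N^{\pi(n)}$ (with $0\in\mathbb N$) is the nonnegative orthant of $\mathbb Z^{\pi(n)}$. $T_n$ is the image of $[n]$ under the map $K_n\to\mathbb O_n$ sending $p_1^{\alpha_1}\cdots p_{\pi(n)}^{\alpha_{\pi(n)}}$ to $(\alpha_1,\dots,\alpha_{\pi(n)})$. A set $A\subseteq\mathbb Z^{\pi(n)}$ tiles a set $C\subseteq\mathbb Z^{\pi(n)}$ ($C$ can be tiled by $A$) if there is a set $B\subseteq\mathbb Z^{\pi(n)}$ such that $C=A+B=\{a+b:a\in A,\,b\in B\}$ and every $c\in C$ has a unique representation $c=a+b$ with $a\in A$, $b\in B$. $A$ essentially tiles $C$ if there is a set $C'\supseteq C$, $C'\subseteq\mathbb Z^{\pi(n)}$, that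 can be tiled by $A$. *)

(* Defs.v *)
From mathcomp Require Import all_boot all_order all_algebra.
From mathcomp Require Import classical_sets.

Import GRing.Theory Num.Theory.

Local Open Scope classical_set_scope.
Local Open Scope ring_scope.

Definition smooth (n : nat) : set nat :=
  [set m | (0 < m)%N /\ forall p, prime p -> (p %| m)%N -> (p <= n)%N].

Definition smooth_rat (n : nat) : set rat :=
  [set x | exists a b, [/\ smooth n a, smooth n b & x = a%:R / b%:R]].

(* [V] is [nat] for K_n and [rat] for its group of quotients. A coloring of [X]
   is given by a total function on [V] whose values outside [X] are irrelevant:
   for [n > 0], every map from [X] to ['I_n] extends to [V]. *)
Definition satisfactory {V : nmodType} {n : nat} (X : set V) (c : V -> 'I_n) :
    Prop :=
  c @` X = [set: 'I_n] /\
  forall a, X a -> forall i j : nat, (1 <= i <= n)%N -> (1 <= j <= n)%N ->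
    i != j -> c (a *+ i) <> c (a *+ j).

Definition primes_upto (n : nat) : seq nat := [seq p <- iota 0 n.+1 | prime p].

Definition primepi (n : nat) : nat := size (primes_upto n).

Definition orthant (n : nat) : set 'rV[int]_(primepi n) :=
  [set v | forall i, 0 <= v ord0 i].

Definition exponents (n m : nat) : 'rV[int]_(primepi n) :=
  \row_(i < primepi n) (logn (nth 0%N (primes_upto n) i) m)%:Z.

Definition prototile (n : nat) : set 'rV[int]_(primepi n) :=
  exponents n @` [set m | (1 <= m <= n)%N].

Definition tiles {V : zmodType} (A C : set V) : Prop :=
  exists B : set V,
    C = [set a + b | a in A & b in B] /\
    forall c, C c -> exists! ab : V * V, [/\ A ab.1, B ab.2 & c = ab.1 + ab.2].

Definition essentially_tiles {V : zmodType} (A C : set V) : Prop :=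
  exists C' : set V, C `<=` C' /\ tiles A C'.

(* Main.v *)
Require Import Defs.
From mathcomp Require Import all_boot all_order all_algebra.
From mathcomp Require Import boolp classical_sets filter.

Import Order.TTheory GRing.Theory Num.Theory.

Local Open Scope classical_set_scope.
Local Open Scope ring_scope.

(** Taking exponents of primes turns multiplication by i in K_n into translation
    by a vector of T_n, so a coloring of K_n is satisfactory exactly when every
    translate a + T_n inside the orthant is rainbow. Such a translate has as many
    points as there are colors, hence exactly one point in the color class S of
    a fixed color. Having a + t in S for exactly one t says that -a is written
    in exactly one way as t + b with b in -S: over the whole lattice, one color
    class of a coloring is, up to sign, the complement B of T_n in a tiling. All
    constructions below therefore go through sets B such that, for each v, there
    is exactly one t in T_n with v - t in B.

    A coloring of K_n, and likewise an essential tiling of the orthant, provides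
    this property only for v in one orthant. Translating by (k, ..., k) yields
    sets B_k with the property on orthants that exhaust the lattice, and
    compactness produces a B that works everywhere. The compactness is a limit
    of the B_k along a nonprincipal ultrafilter ([exact_cover_limit]); it gives
    [coloring_tiles] and [essentially_tiles_orthant_tiles].

    Conversely, given a complement B of T_n in the lattice, color x by the t for
    which -x - t is in B. If x + t and x + t' both have color u, then
    (-x - u) - t and (-x - u) - t' are both in B, so t = t'
    ([tiles_rat_coloring]). The quotients of K_n have exponent vectors in the
    lattice, so this colors them, and the coloring restricts to K_n. *)

(** * Compactness *)

(** An ultrafilter is prime: it cannot contain a finite union of sets without
    containing one of them. *)
Lemma ultra_exists {T : Type} {I : finType} (P : I -> set T) (F : set_system T) :
  UltraFilter F -> (\forall x \near F, exists i, P i x) ->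
  exists i, F (P i).
Proof.
move=> UF FP; apply: contrapT => nP.
have FnP : \forall x \near F, forall i, ~ P i x.
  apply: filter_forall => i.
  by case: (in_ultra_setVsetC (P i) UF) => // FPi; case: nP; exists i.
have [x [[i Pix] nPx]] := filter_ex (filterI FP FnP).
exact: nPx Pix.
Qed.

(** The limit of the B_k consists of the points that lie in B_k for almost all
    k. Each v involves only finitely many points v - e i, so its unique index
    for B_k is the same for almost all k, and this constant is the unique index
    for the limit. *)
Lemma exact_cover_limit {V : zmodType} {I : finType} (e : I -> V)
    (B : nat -> set V) :
  (forall v, \forall k \near \oo, exists! i, B k (v - e i)) ->
  exists B' : set V, forall v, exists! i, B' (v - e i).
Proof.
move=> BP; have [U [UU ooU]] := ultraFilterLemma eventually_filter.
exists [set x | U [set k | B k x]] => v.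
have [i UPi] : exists i, U [set k | unique (fun i => B k (v - e i)) i].
  exact: (ultra_exists (fun i => [set k | unique (fun i => B k (v - e i)) i])
                       U UU (ooU _ (BP v))).
exists i; split; first by apply: filterS UPi => k [].
move=> j Uj; have [k [[_ uniq_i] Bkj]] := filter_ex (filterI UPi Uj).
exact: uniq_i.
Qed.

(** * Tilings and rainbow translates *)

(** Indexing the tile by an injective family makes uniqueness of a pair (a, b)
    into uniqueness of one index, the point b being determined by the index. *)
Lemma tiles_exact_cover {V : zmodType} {I : Type} (e : I -> V) (C : set V) :
  injective e -> tiles (range e) C ->
  exists B : set V, forall v, C v -> exists! i, B (v - e i).
Proof.
move=> e_inj [B [_ CP]]; exists B => v /CP[[_ b] [[/= [i _ <-] Bb ->] uniq_ib]].
exists i; split; first by rewrite addrC addKr.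
move=> j Bj; apply: e_inj.
suff [->] : (e i, b) = (e j, e i + b - e j) by [].
by apply: uniq_ib; split; [exists j | | rewrite /= subrKC].
Qed.

Lemma exact_cover_tiles {V : zmodType} {I : Type} (e : I -> V) (B : set V) :
  (forall v, exists! i, B (v - e i)) -> tiles (range e) [set: V].
Proof.
move=> BP; exists B; split.
  apply/seteqP; split=> // v _; have [i [Bi _]] := BP v.
  by exists (e i); [exists i | exists (v - e i) => //; rewrite /= subrKC].
move=> v _; have [i [Bi uniq_i]] := BP v.
exists (e i, v - e i); split=> [|[_ b] [/= [j _ <-] Bb v_jb]].
  by split; [exists i | | rewrite /= subrKC].
have b_vj : b = v - e j by rewrite v_jb addrC addKr.
by rewrite b_vj (uniq_i j) // -b_vj.
Qed.

(** Multiples are indexed by ['I_n], like the colors: by finiteness, an injective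
    map from multiples to colors is bijective, so that each color occurs exactly
    once among a, 2a, ..., na. *)
Lemma satisfactory_inj {V : nmodType} {n : nat} (X : set V) (c : V -> 'I_n) a :
  satisfactory X c -> X a -> injective (fun i : 'I_n => c (a *+ i.+1)).
Proof.
move=> [_ cP] Xa i j cij; apply: contrapT => /eqP neq_ij.
by apply: (cP a Xa i.+1 j.+1) cij => /=.
Qed.

(** Every color is used since the multiples of a single a0 already carry all of
    them. *)
Lemma inj_satisfactory {V : nmodType} {n : nat} (X : set V) (c : V -> 'I_n) a0 :
  X a0 -> (forall a (i : 'I_n), X a -> X (a *+ i.+1)) ->
  (forall a, X a -> injective (fun i : 'I_n => c (a *+ i.+1))) ->
  satisfactory X c.
Proof.
move=> Xa0 XM c_inj; split.
  apply/seteqP; split=> // k _; have [g _ gK] := injF_bij (c_inj a0 Xa0).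
  by exists (a0 *+ (g k).+1); [exact: XM | exact: gK].
move=> a Xa [//|i] [//|j] /= lt_in lt_jn neq_ij cij.
have /(congr1 val) /= ij := c_inj a Xa (Ordinal lt_in) (Ordinal lt_jn) cij.
by rewrite ij eqxx in neq_ij.
Qed.

(** * Numbers and exponent vectors *)

Lemma mem_primes_upto n p : (p \in primes_upto n) = prime p && (p <= n)%N.
Proof. by rewrite mem_filter mem_iota. Qed.

Definition step {n : nat} (i : 'I_n) : 'rV[int]_(primepi n) := exponents n i.+1.

Lemma prototile_range n : prototile n = range (@step n).
Proof.
apply/seteqP; split=> [_ [[//|m] /= lt_mn <-]|_ [i _ <-]].
  by exists (Ordinal lt_mn).
by exists i.+1 => /=.
Qed.

Lemma exponentsM n a b : (0 < a)%N -> (0 < b)%N ->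
  exponents n (a * b) = exponents n a + exponents n b.
Proof. by move=> a_gt0 b_gt0; apply/rowP => i; rewrite !mxE lognM. Qed.

(** Taking absolute values of the exponents makes the inverse of [exponents] a
    total function; it is multiplicative on the orthant only. *)
Definition number {n : nat} (v : 'rV[int]_(primepi n)) : nat :=
  \prod_(i < primepi n) nth 0%N (primes_upto n) i ^ `|v ord0 i|.

Lemma number_smooth n (v : 'rV[int]_(primepi n)) : smooth n (number v).
Proof.
have pP (i : 'I_(primepi n)) :
    prime (nth 0%N (primes_upto n) i) && (nth 0%N (primes_upto n) i <= n)%N.
  by rewrite -mem_primes_upto mem_nth.
split=> [|p p_pr].
  by apply: prodn_gt0 => i; rewrite expn_gt0 prime_gt0 //; case/andP: (pP i).
rewrite /number; elim/big_ind: _ => [|x y IHx IHy|i _].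
- by rewrite Euclid_dvd1.
- by rewrite Euclid_dvdM // => /orP[].
- have /andP[q_pr q_le] := pP i; rewrite Euclid_dvdX // => /andP[p_q _].
  by move: p_q; rewrite dvdn_prime2 // => /eqP->.
Qed.

Lemma numberD n (u v : 'rV[int]_(primepi n)) : orthant n u -> orthant n v ->
  number (u + v) = (number u * number v)%N.
Proof.
move=> u_ge0 v_ge0; rewrite /number -big_split /=; apply: eq_bigr => i _.
rewrite -expnD; congr (_ ^ _)%N; rewrite mxE.
by case: (u ord0 i) (v ord0 i) (u_ge0 i) (v_ge0 i) => [a|a] [b|b].
Qed.

Lemma exponents_orthant n m : orthant n (exponents n m).
Proof. by move=> i; rewrite mxE. Qed.

Lemma number_step n (i : 'I_n) : number (step i) = i.+1.
Proof.
rewrite /number /step.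
under eq_bigr do rewrite mxE absz_nat.
rewrite -(big_mkord predT (fun j => nth 0%N (primes_upto n) j ^
   logn (nth 0%N (primes_upto n) j) i.+1)%N).
rewrite -(big_nth 0%N predT (fun p => p ^ logn p i.+1)%N) big_filter.
rewrite -[RHS]partnT // (widen_partn _ (ltn_ord i)) big_mkcond /=.
rewrite /index_iota subn0; apply: eq_bigr => p _.
by case: ifP => // p_npr; rewrite lognE p_npr.
Qed.

Lemma step_inj n : injective (@step n).
Proof.
move=> i j eij; apply/val_inj/succn_inj.
by rewrite -[LHS]number_step eij number_step.
Qed.

(** Translating by (k, ..., k) brings any point into the orthant: this is how the
    orthant hypotheses reach the whole lattice in the limit. *)
Lemma near_orthant n (v : 'rV[int]_(primepi n)) :
  \forall k \near \oo, orthant n (v + const_mx k%:Z).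
Proof.
exists (\sum_i `|v ord0 i|)%N => // k /= le_k i; rewrite !mxE.
have le_ik : (`|v ord0 i| <= k)%N.
  by apply: leq_trans le_k; rewrite (bigD1 i) //= leq_addr.
rewrite -lerBlDr sub0r lerNl; apply: le_trans (_ : `|v ord0 i| <= _).
  by rewrite lerNl; exact: lerNnormlW.
by rewrite -abszE lez_nat.
Qed.

(** * From the orthant to the lattice *)

(** The complement B is the negative of the class of one color, here color 0.
    Accordingly, B_k is read off the coloring at (k, ..., k) - x, so that the
    condition at v concerns the translate of T_n at (k, ..., k) - v. *)
Lemma coloring_tiles n : (0 < n)%N ->
  (exists c : nat -> 'I_n, satisfactory (smooth n) c) ->
  tiles (prototile n) [set: 'rV[int]_(primepi n)].
Proof.
move=> n_gt0 [c c_sat]; rewrite prototile_range.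
have [B BP] : exists B : set 'rV[int]_(primepi n),
    forall v, exists! i, B (v - step i).
  apply: (exact_cover_limit _
    (fun k => [set x | c (number (- x + const_mx k%:Z)) = Ordinal n_gt0])) => v.
  apply: filterS (near_orthant n (- v)) => k vk_ge0.
  have c_inj := satisfactory_inj _ _ _ c_sat (number_smooth n (- v + const_mx k%:Z)).
  (* Removing tile vector i from v multiplies the number to be colored by i + 1. *)
  have cE i : c (number (- (v - step i) + const_mx k%:Z)) =
              c (number (- v + const_mx k%:Z) *+ i.+1).
    rewrite opprB addrC addrCA addrC [const_mx _ - v]addrC numberD //.
      by rewrite number_step -[RHS]/(c _) -mulr_natr natn.
    exact: exponents_orthant.
  have [g gK' gK] := injF_bij c_inj.
  exists (g (Ordinal n_gt0)); split=> [|j].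
    by rewrite /= cE gK.
  by rewrite /= cE => <-; rewrite gK'.
exact: exact_cover_tiles BP.
Qed.

Lemma essentially_tiles_orthant_tiles n :
  essentially_tiles (prototile n) (orthant n) ->
  tiles (prototile n) [set: 'rV[int]_(primepi n)].
Proof.
rewrite prototile_range => -[C [OC /(tiles_exact_cover _ _ (step_inj n))[B BP]]].
have [B' B'P] : exists B' : set 'rV[int]_(primepi n),
    forall v, exists! i, B' (v - step i).
  apply: (exact_cover_limit _ (fun k => [set x | B (x + const_mx k%:Z)])) => v.
  apply: filterS (near_orthant n v) => k /OC/BP[i [Bi uniq_i]].
  by exists i; split=> [|j]; rewrite /= addrAC //; exact: uniq_i.
exact: exact_cover_tiles B'P.
Qed.

(** * Coloring the quotients *)

Definition rat_exponents (n : nat) (x : rat) : 'rV[int]_(primepi n) :=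
  exponents n `|numq x| - exponents n `|denq x|.

(** The exponents of a fraction may be computed without reducing it: cross
    multiplication with the reduced form is an equality of natural numbers, to
    which [exponentsM] applies. *)
Lemma rat_exponents_frac n a b : (0 < a)%N -> (0 < b)%N ->
  rat_exponents n (a%:R / b%:R) = exponents n a - exponents n b.
Proof.
move=> a_gt0 b_gt0; set x : rat := _ / _.
have x_gt0 : 0 < x by rewrite divr_gt0 ?ltr0n.
have num_gt0 : (0 < `|numq x|)%N by rewrite absz_gt0 numq_eq0 gt_eqF.
have den_gt0 : (0 < `|denq x|)%N by rewrite absz_gt0 denq_neq0.
have E : (`|numq x| * b = a * `|denq x|)%N.
  apply/eqP; rewrite -(eqr_nat rat) !natrM.
  rewrite !natr_absz ger0_norm ?numq_ge0 ?ltW // (ger0_norm (denq_ge0 x)).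
  rewrite -[X in X%:~R * _]/(numq x) -[X in _ == _ * X%:~R]/(denq x).
  by rewrite -eqr_div ?divq_num_den ?pnatr_eq0 -?lt0n // intr_eq0 denq_neq0.
apply/eqP; rewrite subr_eq addrAC -exponentsM // -E.
by rewrite exponentsM // addrK.
Qed.

Lemma rat_exponentsMn n x (i : 'I_n) : smooth_rat n x ->
  rat_exponents n (x *+ i.+1) = rat_exponents n x + step i.
Proof.
move=> [a [b [[a_gt0 _] [b_gt0 _] ->]]].
rewrite -mulrnAl -mulrnA !rat_exponents_frac ?muln_gt0 ?a_gt0 //.
by rewrite exponentsM // addrAC.
Qed.

Lemma smoothM n a b : smooth n a -> smooth n b -> smooth n (a * b)%N.
Proof.
move=> [a_gt0 aP] [b_gt0 bP]; split; first by rewrite muln_gt0 a_gt0.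
by move=> p p_pr; rewrite Euclid_dvdM // => /orP[/aP|/bP]; apply.
Qed.

Lemma smooth_le n m : (0 < m <= n)%N -> smooth n m.
Proof.
move=> /andP[m_gt0 le_mn]; split=> // p _ p_m.
exact: leq_trans (dvdn_leq m_gt0 p_m) le_mn.
Qed.

Lemma smooth1 n : smooth n 1%N.
Proof. by split=> // p p_pr; rewrite Euclid_dvd1. Qed.

Lemma smooth_ratMn n x (i : 'I_n) : smooth_rat n x -> smooth_rat n (x *+ i.+1).
Proof.
move=> [a [b [Sa Sb ->]]]; exists (a * i.+1)%N, b; split=> //.
  by apply: smoothM => //; apply: smooth_le => /=.
by rewrite -mulrnAl -mulrnA.
Qed.

Lemma smooth_rat_nat n a : smooth n a -> smooth_rat n a%:R.
Proof. by exists a, 1%N; split; rewrite ?divr1 //; exact: smooth1. Qed.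

(** The color of x is the index of the tile vector in the decomposition of -x;
    the sign is what makes this work, since two multiples of x with the same
    color yield two decompositions of one vector. *)
Lemma tiles_rat_coloring n : tiles (prototile n) [set: 'rV[int]_(primepi n)] ->
  exists c : rat -> 'I_n, satisfactory (smooth_rat n) c.
Proof.
rewrite prototile_range => /(tiles_exact_cover _ _ (step_inj n))[B BP].
have [f fP] : {f : 'rV[int]_(primepi n) -> 'I_n & forall v, B (v - step (f v))}.
  apply: (@boolp.choice _ _ (fun v i => B (v - step i))) => v.
  by have [i []] := BP v Logic.I; exists i.
exists (fun x => f (- rat_exponents n x)).
apply: (inj_satisfactory _ _ 1) => [|x i|x Xx i j /= fij].
- exact: (smooth_rat_nat n 1 (smooth1 n)).
- exact: smooth_ratMn.
(* With u the common color of ix and jx, both i and j decompose -x - u. *)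
have [k [_ uniq_k]] :=
  BP (- rat_exponents n x - step (f (- rat_exponents n (x *+ i.+1)))) Logic.I.
rewrite -(uniq_k i) ?(uniq_k j) //.
  by rewrite addrAC fij -opprD -rat_exponentsMn.
by rewrite addrAC -opprD -rat_exponentsMn.
Qed.

(** Restricting along the embedding of K_n in its quotients suffices, because
    it commutes with multiples. *)
Lemma rat_coloring_coloring n :
  (exists c : rat -> 'I_n, satisfactory (smooth_rat n) c) ->
  exists c : nat -> 'I_n, satisfactory (smooth n) c.
Proof.
move=> [c c_sat]; exists (fun m => c m%:R).
have natM a i : a *+ i = (a * i)%N by rewrite -mulr_natr natn.
apply: (inj_satisfactory _ _ 1%N) => [|a i Xa|a Xa i j /= cij].
- exact: smooth1.
- by rewrite natM; apply: smoothM => //; apply: smooth_le => /=.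
apply: (satisfactory_inj _ _ _ c_sat (smooth_rat_nat n a Xa)).
by rewrite /= -!mulrnA -!natM.
Qed.

Theorem proposition2p12 (n : nat) (hn : (0 < n)%N) :
  ((exists c : nat -> 'I_n, satisfactory (smooth n) c) ->
    tiles (prototile n) [set: 'rV[int]_(primepi n)]) /\
  [<-> exists c : nat -> 'I_n, satisfactory (smooth n) c;
       essentially_tiles (prototile n) (orthant n);
       tiles (prototile n) [set: 'rV[int]_(primepi n)];
       exists c : rat -> 'I_n, satisfactory (smooth_rat n) c].
Proof.
split; first exact: coloring_tiles.
tfae.
- by move=> /(coloring_tiles n hn) tilesT; exists setT.
- exact: essentially_tiles_orthant_tiles.
- exact: tiles_rat_coloring.
- exact: rat_coloring_coloring.
Qed.
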